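(* Let $A$ be a commutative real algebra with unit element $1$. Suppose that either $C$ is an $S$-module for some Archimedean semiring $S$ of $A$, or $C$ is an Archimedean quadratic module of $A$. Let $\mathcal{K}(C)$ be the set of all unital algebra homomorphisms $\chi:A\to\mathbb{R}$ such that $\chi(c)\ge 0$ for all $c\in C$. Then for any $a\in A$ the following are equivalent: (i) $\chi(a)>0$ for all $\chi\in\mathcal{K}(C)$. (ii) There exists $\epsilon\in(0,+\infty)$ such that $a\in\epsilon+C$ (that is, $a-\epsilon\cdot 1\in C$).
   Context: For $\lambda\in\mathbb{R}$ we write $\lambda$ for $\lambda\cdot 1\in A$. A unital cone of $A$ is a subset $C\subseteq A$ with $C+C\subseteq C$, $\lambda C\subseteq C$ for all real $\lambda\ge0$, and $1\in C$. A quadratic module of $A$ is a subset $Q$ with $Q+Q\subseteq Q$, $1\in Q$, and $a^2Q\subseteq Q$ for all $a\in A$. A semiring of $A$ is a subset $S$ with $S+S\subseteq S$, $S\cdot S\subseteq S$, and $\lambda\in S$ for all real $\lambda\ge 0$. For a semiring $S$, an $S$-module is a unital cone $C$ such that $ac\in C$ for all $a\in S$, $c\in C$. Semirings and quadratic modules are unital cones. A unital cone $C$ is Archimedean if for every $a\in A$ there exists $\lambda>0$ such that $\lambda-a\in C$. *)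

(* Defs.v *)
From HB Require Import structures.
From mathcomp Require Import all_boot all_order all_algebra.
From mathcomp Require Import boolp classical_sets reals.

Set Implicit Arguments.
Unset Strict Implicit.
Unset Printing Implicit Defensive.

Import Order.TTheory GRing.Theory Num.Theory.
Local Open Scope ring_scope.
Local Open Scope classical_set_scope.

(* A real [l] is viewed in the algebra [A] as [l%:A], i.e. [l *: 1]. *)

Definition unital_cone (R : realType) (A : comAlgType R) (C : set A) : Prop :=
  [/\ forall c d, C c -> C d -> C (c + d),
      forall (l : R) c, 0 <= l -> C c -> C (l *: c)
    & C 1].

Definition quadratic_module (R : realType) (A : comAlgType R) (Q : set A) :
    Prop :=
  [/\ forall p q, Q p -> Q q -> Q (p + q),
      Q 1
    & forall a q, Q q -> Q (a ^+ 2 * q)].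

Definition semiring (R : realType) (A : comAlgType R) (S : set A) : Prop :=
  [/\ forall s t, S s -> S t -> S (s + t),
      forall s t, S s -> S t -> S (s * t)
    & forall l : R, 0 <= l -> S l%:A].

Definition semiring_module (R : realType) (A : comAlgType R) (S C : set A) :
    Prop :=
  unital_cone C /\ forall s c, S s -> C c -> C (s * c).

Definition archimedean (R : realType) (A : comAlgType R) (C : set A) : Prop :=
  forall a : A, exists2 l : R, 0 < l & C (l%:A - a).

(* The regular algebra [R^o] is [R] seen as an algebra over itself, so the
   elements of [{lrmorphism A -> R^o}] are the unital algebra homomorphisms
   from [A] to [R]. *)
Definition characters (R : realType) (A : comAlgType R) (C : set A) :
    set {lrmorphism A -> R^o} :=
  [set chi : {lrmorphism A -> R^o} | forall c, C c -> 0 <= (chi c : R)].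

(* Main.v *)
Require Import Defs.
From HB Require Import structures.
From mathcomp Require Import all_boot all_order all_algebra.
From mathcomp Require Import boolp classical_sets reals.
From mathcomp Require Import ring lra.

Set Implicit Arguments.
Unset Strict Implicit.
Unset Printing Implicit Defensive.

Import Order.TTheory GRing.Theory Num.Theory.
Local Open Scope ring_scope.
Local Open Scope classical_set_scope.

(** Only the passage from positivity of [a] on the characters to membership of
    [a - eps] in [C] is difficult.

    Let [C] be a module over an Archimedean semiring [S], and adjoin [- a] to
    it, forming the module of all [m - s * a] with [m] in [C] and [s] in [S].
    If this module does not contain [-1], Zorn's lemma enlarges it to a maximal
    module [M] without [-1].  Maximality forces [M] and [- M] to cover [A]
    ([maximal_module_total]), so that modulo [M] every element of [A] is
    infinitely close to exactly one real number, its value.  The value is a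
    character, nonnegative on [M] ([maximal_module_character]), hence one that
    is nonnegative on [C] but not positive at [a]: a contradiction.  So
    [-1 = m - s * a], that is, [s * a - 1] lies in [C].  With [k - s] in [S],
    multiplying [a + r] by [k - s] then shows that [a + r] in [C] with
    [0 <= r] implies [a + (r - 1 / k)] in [C].  Starting from any [r] given by
    the Archimedean property, finitely many steps make [r] negative
    ([improper_bound]).

    An Archimedean quadratic module [Q] is reduced to this case.  Its closure,
    the set of all [x] with [x + e] in [Q] for all [e > 0], is a module over the
    semiring of its multipliers, and this semiring is Archimedean because it
    contains [1 - y] as soon as [1 - y ^+ 2] is in [Q]
    ([one_sub_multiplier]).  The margin [eps] absorbs the passage from the
    closure back to [Q]. *)

(** * Cones and modules *)

Lemma scale_in_alg (R : realType) (A : comAlgType R) (l : R) (x : A) :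
  l *: x = in_alg A l * x.
Proof. by rewrite mulr_algl. Qed.

(** Turning scalings into products with images of the morphism [in_alg A]
    makes identities in [A] accessible to [ring]. *)
Ltac alg_ring := rewrite ?scale_in_alg; ring.

Lemma cone_scalar (R : realType) (A : comAlgType R) (C : set A) (l : R) :
  unital_cone C -> 0 <= l -> C l%:A.
Proof. by move=> [_ CZ C1] l0; apply: CZ. Qed.

Lemma semiring_sub_module (R : realType) (A : comAlgType R) (S C : set A) :
  semiring_module S C -> S `<=` C.
Proof. by move=> [[_ _ C1] SC] s /SC /(_ C1); rewrite mulr1. Qed.

Definition adjoin (R : realType) (A : comAlgType R) (S C : set A) (y : A) :
    set A :=
  [set x | exists m s, [/\ C m, S s & x = m + s * y]].

Lemma adjoin_module (R : realType) (A : comAlgType R) (S C : set A) (y : A) :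
  semiring S -> semiring_module S C -> semiring_module S (adjoin S C y).
Proof.
move=> [SD SM SR] [[CD CZ C1] SC].
have S0 : S 0 by rewrite -(scale0r 1); apply: SR.
split; first split.
- move=> _ _ [m [s [Cm Ss ->]]] [n [t [Cn St ->]]].
  exists (m + n), (s + t); split; [exact: CD|exact: SD|ring].
- move=> l _ l0 [m [s [Cm Ss ->]]].
  exists (l *: m), (l%:A * s); split; first exact: CZ.
    by apply: SM => //; apply: SR.
  alg_ring.
- by exists 1, 0; split => //; rewrite mul0r addr0.
- move=> t _ St [m [s [Cm Ss ->]]].
  exists (t * m), (t * s); split; [exact: SC|exact: SM|ring].
Qed.

Lemma sub_adjoin (R : realType) (A : comAlgType R) (S C : set A) (y : A) :
  semiring S -> C `<=` adjoin S C y.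
Proof.
move=> [_ _ SR] c Cc; exists c, 0; split => //; last by rewrite mul0r addr0.
by rewrite -(scale0r 1); apply: SR.
Qed.

Lemma adjoin_gen (R : realType) (A : comAlgType R) (S C : set A) (y : A) :
  semiring S -> semiring_module S C -> adjoin S C y y.
Proof.
move=> [_ _ SR] [[_ CZ C1] _]; exists 0, 1; split; last by rewrite mul1r add0r.
- by rewrite -(scale0r 1); apply: CZ.
- by rewrite -(scale1r 1); apply: SR.
Qed.

(** * Maximal proper modules *)

Definition proper_module (R : realType) (A : comAlgType R) (S M : set A) :
    Prop :=
  semiring_module S M /\ ~ M (-1).

Definition maximal_module (R : realType) (A : comAlgType R) (S M : set A) :
    Prop :=
  proper_module S M /\ forall N, M `<=` N -> proper_module S N -> N `<=` M.

Lemma exists_maximal_module (R : realType) (A : comAlgType R) (S C : set A) :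
  proper_module S C -> exists2 M, C `<=` M & maximal_module S M.
Proof.
move=> propC.
(* The empty chain has an empty union, which is why empty sets are admitted. *)
pose P (X : set A) := X !=set0 -> C `<=` X /\ proper_module S X.
have [|M [PM maxM]] := @Zorn_bigcup A P.
- move=> F FP totF [x [X FX Xx]].
  have good Y z : F Y -> Y z -> C `<=` Y /\ proper_module S Y.
    by move=> FY Yz; apply: (FP _ FY); exists z.
  have [CX [[[_ _ X1] _] _]] := good _ _ FX Xx.
  split; first by move=> c Cc; exists X => //; apply: CX.
  split; last first.
    by move=> [Y FY Y1]; have [_ [_]] := good _ _ FY Y1; apply.
  split; first split.
  + move=> c d [Y FY Yc] [Z FZ Zd].
    have [_ [[[YD _ _] _] _]] := good _ _ FY Yc.
    have [_ [[[ZD _ _] _] _]] := good _ _ FZ Zd.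
    have [YZ|ZY] := totF _ _ FY FZ.
      by exists Z => //; apply: ZD => //; apply: YZ.
    by exists Y => //; apply: YD => //; apply: ZY.
  + move=> l c l0 [Y FY Yc].
    have [_ [[[_ YZ _] _] _]] := good _ _ FY Yc.
    by exists Y => //; apply: YZ.
  + by exists X.
  + move=> s c Ss [Y FY Yc].
    have [_ [[_ SY] _]] := good _ _ FY Yc.
    by exists Y => //; apply: SY.
have PC : P C by move=> _; split=> //; apply: subset_refl.
have [C0|/nonemptyPn M0] := pselect (M !=set0).
  have [CM pM] := PM C0; exists M => //; split => // N MN pN.
  apply: contrapT => NM; apply: (maxM N).
    by split.
  by move=> _; split => // c /CM /MN.
exfalso; apply: (maxM C _ PC); rewrite M0; split; first exact: sub0set.
by case: propC => -[[_ _ C1] _] _ /(_ _ C1).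
Qed.

Lemma proper_scalar_ge0 (R : realType) (A : comAlgType R) (S M : set A)
    (l : R) :
  proper_module S M -> M l%:A -> 0 <= l.
Proof.
move=> [[[_ MZ _] _] M1] Ml; rewrite leNgt; apply/negP => l0; apply: M1.
have := MZ (- l)^-1 _ _ Ml; rewrite scalerA invrN mulNr mulVf ?lt_eqF//.
by rewrite scaleN1r; apply; rewrite -invrN invr_ge0 oppr_ge0 ltW.
Qed.

(** The intersection of [M] and [- M] is closed under multiplication by [S], and
    every element of [A] is a scalar minus an element of [S]. *)
Lemma support_ideal (R : realType) (A : comAlgType R) (S M : set A) (x z : A) :
  archimedean S -> semiring_module S M -> M z -> M (- z) -> M (x * z).
Proof.
move=> arS [[MD MZ _] SM] Mz MNz; have [l l0 Sl] := arS x.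
have -> : x * z = l *: z + (l%:A - x) * - z by alg_ring.
by apply: MD; [apply: MZ => //; exact: ltW|exact: SM].
Qed.

(** If [x] is not in [M], maximality gives [-1 = m + s * x], so [s * - x = 1 + m]
    is in [M].  The set of all [z] with [s * z] in [M] is a module containing [M],
    and a proper one: otherwise [s] would lie in the ideal where [M] and [- M]
    meet, which would put [-1] in [M].  By maximality this set, which contains
    [- x], is [M] itself. *)
Lemma maximal_module_total (R : realType) (A : comAlgType R) (S M : set A)
    (x : A) :
  semiring S -> archimedean S -> maximal_module S M -> M x \/ M (- x).
Proof.
move=> srS arS [[modM M1] maxM]; have [[MD MZ Mone] SM] := modM.
have [Mx|nMx] := pselect (M x); [by left|right].
have [m [s [Mm Ss E]]] : adjoin S M x (-1).
  apply: contrapT => N1; apply: nMx; apply: (maxM (adjoin S M x)).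
  - exact: sub_adjoin.
  - by split => //; apply: adjoin_module.
  - exact: adjoin_gen.
have Ms : M s := semiring_sub_module modM Ss.
apply: (maxM [set z | M (s * z)]) => /=.
- by move=> z; apply: SM.
- split; first split; first split => /=.
  + by move=> c d Mc Md; rewrite mulrDr; apply: MD.
  + by move=> l c l0 Mc; rewrite -scalerAr; apply: MZ.
  + by rewrite mulr1.
  + by move=> t c St Mc /=; rewrite mulrCA; apply: SM.
  + rewrite /= mulrN1 => MNs; apply: M1; rewrite E.
    by apply: MD => //; rewrite mulrC; apply: support_ideal MNs.
- have -> : s * - x = 1 + m by rewrite mulrN -[1]opprK E; ring.
  exact: MD.
Qed.

(** * The character of a maximal proper module *)

(** Modulo [M], [x] is infinitely close to the scalar [r].  Stating this without
    [sup] makes the algebraic properties of the value consequences of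
    its uniqueness. *)
Definition value (R : realType) (A : comAlgType R) (M : set A) (x : A)
    (r : R) : Prop :=
  forall e, 0 < e -> M (x - (r - e)%:A) /\ M ((r + e)%:A - x).

(** The value is the supremum of the scalars below [x].  A scalar greater than it
    is not below [x], hence is above [x] because [M] and [- M] cover [A]. *)
Lemma exists_value (R : realType) (A : comAlgType R) (S M : set A) (x : A) :
  semiring S -> archimedean S -> maximal_module S M -> exists r, value M x r.
Proof.
move=> srS arS maxM; have [pM _] := maxM; have [modM _] := pM.
have SM := semiring_sub_module modM; have [coneM _] := modM.
have [MD _ _] := coneM.
pose E := [set r | M (x - r%:A)].
have supE : has_sup E.
  split.
    have [l l0 /SM Ml] := arS (- x); exists (- l); rewrite /E /=.
    by rewrite scaleNr opprK addrC -[x]opprK.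
  have [l l0 /SM Ml] := arS x; exists l => r /= Er.
  rewrite -subr_ge0; apply: (proper_scalar_ge0 pM).
  have -> : (l - r)%:A = (l%:A - x) + (x - r%:A) :> A by alg_ring.
  exact: MD.
exists (sup E) => e e0; split.
  have [t Et rt] := sup_adherent e0 supE.
  have -> : x - (sup E - e)%:A = (x - t%:A) + (t - (sup E - e))%:A by alg_ring.
  by apply: MD => //; apply: cone_scalar => //; rewrite subr_ge0 ltW.
have [Mx|] := maximal_module_total (x - (sup E + e)%:A) srS arS maxM.
  have := ub_le_sup (proj2 supE) Mx.
  by rewrite leNgt ltrDl e0.
by rewrite opprB.
Qed.

Lemma value_unique (R : realType) (A : comAlgType R) (S M : set A) (x : A)
    (r t : R) :
  proper_module S M -> value M x r -> value M x t -> r = t.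
Proof.
move=> pM; wlog rt : r t / r < t => [H xr xt|xr xt].
  by case: (ltgtP r t) => // ?; [apply: H|apply/esym/H].
have [[[MD _ _] _] _] := pM.
have e0 : 0 < (t - r) / 4 by lra.
have := proper_scalar_ge0 (l := r - t + (t - r) / 4 + (t - r) / 4) pM.
have -> : (r - t + (t - r) / 4 + (t - r) / 4)%:A =
    ((r + (t - r) / 4)%:A - x) + (x - (t - (t - r) / 4)%:A) by alg_ring.
move=> /(_ (MD _ _ (xr _ e0).2 (xt _ e0).1)); lra.
Qed.

Lemma value_ge0 (R : realType) (A : comAlgType R) (S M : set A) (x : A)
    (r : R) :
  proper_module S M -> M x -> value M x r -> 0 <= r.
Proof.
move=> pM Mx xr; have [[[MD _ _] _] _] := pM.
apply/ler_addgt0Pr => e e0; apply: (proper_scalar_ge0 pM).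
by rewrite -[X in M X](subrK x); apply: MD => //; apply: (xr _ e0).2.
Qed.

Lemma value_scalar (R : realType) (A : comAlgType R) (M : set A) (l : R) :
  unital_cone M -> value M l%:A l.
Proof.
move=> coneM e /ltW e0; have Me : M e%:A by apply: cone_scalar.
by split; [have -> : l%:A - (l - e)%:A = e%:A :> A by alg_ring|
           have -> : (l + e)%:A - l%:A = e%:A :> A by alg_ring].
Qed.

Lemma valueD (R : realType) (A : comAlgType R) (M : set A) (x y : A)
    (r t : R) :
  unital_cone M -> value M x r -> value M y t -> value M (x + y) (r + t).
Proof.
move=> [MD _ _] xr yt e e0.
have e2 : 0 < e / 2 by lra.
have [x1 x2] := xr _ e2; have [y1 y2] := yt _ e2.
have E : e = e / 2 + e / 2 by field.
split.
- have -> : x + y - (r + t - e)%:A =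
      (x - (r - e / 2)%:A) + (y - (t - e / 2)%:A) by rewrite {1}E; alg_ring.
  exact: MD.
- have -> : (r + t + e)%:A - (x + y) =
      ((r + e / 2)%:A - x) + ((t + e / 2)%:A - y) by rewrite {1}E; alg_ring.
  exact: MD.
Qed.

Lemma valueZ (R : realType) (A : comAlgType R) (M : set A) (l : R) (x : A)
    (r : R) :
  unital_cone M -> value M x r -> value M (l *: x) (l * r).
Proof.
move=> coneM; have [MD MZ M1] := coneM.
have pos k y t : 0 < k -> value M y t -> value M (k *: y) (k * t).
  move=> k0 yt e e0; have [y1 y2] := yt (e / k) (divr_gt0 e0 k0).
  have E : e = k * (e / k) by field; apply: lt0r_neq0.
  split.
  - have -> : k *: y - (k * t - e)%:A = k *: (y - (t - e / k)%:A).
      by rewrite {1}E; alg_ring.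
    exact/MZ/y1/ltW.
  - have -> : (k * t + e)%:A - k *: y = k *: ((t + e / k)%:A - y).
      by rewrite {1}E; alg_ring.
    exact/MZ/y2/ltW.
move=> xr; case: (ltgtP l 0) => [l0|l0|->].
- rewrite -[l]opprK mulNr -mulrN scaleNr -scalerN.
  apply: pos; first by rewrite oppr_gt0.
  move=> e /xr[x1 x2]; split.
  + by have -> : - x - (- r - e)%:A = (r + e)%:A - x by alg_ring.
  + by have -> : (- r + e)%:A - - x = x - (r - e)%:A by alg_ring.
- exact: pos.
- by rewrite mul0r scale0r -(scale0r 1); apply: value_scalar.
Qed.

(** For [s] in [S], [s * x] is squeezed between [- e * s] and [e * s], and [s] is
    bounded by a scalar; an arbitrary [y] is a scalar minus an element of [S].
    Positivity is used only for products with [S], since [M] need not be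
    closed under products. *)
Lemma value0_mul (R : realType) (A : comAlgType R) (S M : set A) (x y : A) :
  archimedean S -> semiring_module S M -> value M x 0 -> value M (y * x) 0.
Proof.
move=> arS [coneM SM] x0; have [MD MZ M1] := coneM.
have inS s : S s -> value M (s * x) 0.
  move=> Ss e e0; have [k k0 Sk] := arS s.
  have [] := x0 (e / k) (divr_gt0 e0 k0); rewrite sub0r add0r => x1 x2.
  have Mk : M ((k%:A - s) * (e / k)%:A).
    by apply: SM => //; apply: cone_scalar => //; rewrite divr_ge0// ltW.
  have E : e = k * (e / k) by field; apply: lt0r_neq0.
  rewrite sub0r add0r; split.
  - have -> : s * x - (- e)%:A =
        s * (x - (- (e / k))%:A) + (k%:A - s) * (e / k)%:A.
      by rewrite {1}E; alg_ring.
    by apply: MD => //; apply: SM.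
  - have -> : e%:A - s * x =
        s * ((e / k)%:A - x) + (k%:A - s) * (e / k)%:A.
      by rewrite {1}E; alg_ring.
    by apply: MD => //; apply: SM.
have [l _ Sl] := arS y.
have -> : y * x = l *: x + -1 *: ((l%:A - y) * x) by alg_ring.
have -> : 0 = l * 0 + -1 * 0 :> R by ring.
by apply: valueD => //; apply: valueZ => //; apply: inS.
Qed.

(** Subtracting [t] from [y] reduces to a factor of value [0]. *)
Lemma valueM (R : realType) (A : comAlgType R) (S M : set A) (x y : A)
    (r t : R) :
  archimedean S -> semiring_module S M ->
  value M x r -> value M y t -> value M (x * y) (r * t).
Proof.
move=> arS modM xr yt; have [coneM _] := modM.
have -> : x * y = x * (y + (- t)%:A) + t *: x by alg_ring.
have -> : r * t = 0 + t * r by ring.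
apply: valueD => //; last exact: valueZ.
apply: value0_mul arS modM _; rewrite -(subrr t).
by apply: valueD => //; apply: value_scalar.
Qed.

Lemma maximal_module_character (R : realType) (A : comAlgType R)
    (S M : set A) :
  semiring S -> archimedean S -> maximal_module S M ->
  exists chi : {lrmorphism A -> R^o}, characters M chi.
Proof.
move=> srS arS maxM; have [pM _] := maxM; have [modM _] := pM.
have [coneM _] := modM.
have /choice[f fP] : forall x, exists r, value M x r.
  by move=> x; apply: exists_value srS arS maxM.
have fE x r : value M x r -> f x = r by exact: value_unique pM (fP x).
pose g : A -> R^o := f.
have g_lin : linear_for *:%R g.
  move=> l x y; apply: fE.
  by apply: valueD => //; apply: valueZ.
have g_mul : monoid_morphism g.
  split; first by apply: fE; rewrite -(scale1r 1); apply: value_scalar.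
  by move=> x y; apply: fE; apply: valueM arS modM _ _.
pose gL := GRing.isLinear.Build R A R^o *:%R g g_lin.
pose gM := GRing.isMonoidMorphism.Build A R^o g g_mul.
pose chi : {lrmorphism A -> R^o} := HB.pack g gL gM.
exists chi => c Mc.
exact: value_ge0 pM Mc (fP c).
Qed.

(** * Semirings *)

(** Each multiplication by [k - s] lowers by [1 / k] a nonnegative constant [r] with
    [a + r] in [C]: modulo [C], [(k - s) * (a + r)] is
    [k * (a + r) - s * a - r * s], and [s * a - 1] and [r * s] are in [C]. *)
Lemma improper_bound (R : realType) (A : comAlgType R) (S C : set A)
    (a s : A) :
  archimedean S -> semiring_module S C -> S s -> C (s * a - 1) ->
  exists2 eps : R, 0 < eps & C (a - eps%:A).
Proof.
move=> arS modC Ss Csa; have SC := semiring_sub_module modC.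
have [[CD CZ C1] SM] := modC.
have [k k0 Sk] := arS s.
have step r : 0 <= r -> C (a + r%:A) -> C (a + (r - k^-1)%:A).
  move=> r0 Ca.
  have -> : a + (r - k^-1)%:A = k^-1 *:
      ((k%:A - s) * (a + r%:A) + (s * a - 1) + r *: s).
    have -> : (k%:A - s) * (a + r%:A) + (s * a - 1) + r *: s =
      k *: (a + r%:A) - 1 by alg_ring.
    rewrite scalerBr scalerA mulVf ?lt0r_neq0// scale1r; alg_ring.
  apply: (CZ); first by rewrite invr_ge0 ltW.
  apply: (CD); last by apply: CZ => //; apply: SC.
  by apply: CD => //; apply: SM.
have descent (n : nat) (r : R) : r < n%:R / k -> C (a + r%:A) ->
    exists2 eps : R, 0 < eps & C (a - eps%:A).
  (* The bound is strict so that [n = 0] already makes [r] negative. *)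
  elim: n r => [|n IHn] r rn Cr.
    exists (- r); first by rewrite oppr_gt0; move: rn; rewrite mul0r.
    by rewrite scaleNr opprK.
  case: (ltP r 0) => [r0|r0].
    exists (- r); first by rewrite oppr_gt0.
    by rewrite scaleNr opprK.
  apply: (IHn (r - k^-1)); last exact: step.
  by move: rn; rewrite -natr1 mulrDl mul1r ltrBlDr.
have [r r0 /SC Cr] := arS (- a).
apply: (descent (Num.bound (r * k)) r).
  by rewrite ltr_pdivlMr// archi_boundP// mulr_ge0// ltW.
by rewrite addrC -[a]opprK.
Qed.

Lemma module_positivstellensatz (R : realType) (A : comAlgType R)
    (S C : set A) (a : A) :
  semiring S -> archimedean S -> semiring_module S C ->
  (forall chi : {lrmorphism A -> R^o}, characters C chi -> 0 < (chi a : R)) ->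
  exists2 eps : R, 0 < eps & C (a - eps%:A).
Proof.
move=> srS arS modC apos.
have [m [s [Cm Ss E]]] : adjoin S C (- a) (-1).
  apply: contrapT => N1.
  have [|M CM maxM] := @exists_maximal_module R A S (adjoin S C (- a)).
    by split => //; apply: adjoin_module.
  have [chi chiM] := maximal_module_character srS arS maxM.
  have /apos : characters C chi.
    by move=> c Cc; apply/chiM/CM/sub_adjoin.
  have : 0 <= (chi (- a) : R) by apply/chiM/CM/adjoin_gen.
  by rewrite rmorphN oppr_ge0 leNgt => /negP.
apply: improper_bound arS modC Ss _.
by have -> : s * a - 1 = m by rewrite E; ring.
Qed.

(** * Quadratic modules *)

Definition cone_closure (R : realType) (A : comAlgType R) (C : set A) :
    set A :=
  [set x | forall e : R, 0 < e -> C (x + e%:A)].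

(** For the closure of a quadratic module this takes over the role of a semiring
    given in advance. *)
Definition multipliers (R : realType) (A : comAlgType R) (C : set A) :
    set A :=
  [set b | forall c, C c -> C (b * c)].

Lemma sub_cone_closure (R : realType) (A : comAlgType R) (C : set A) :
  unital_cone C -> C `<=` cone_closure C.
Proof.
move=> coneC c Cc e e0; have [CD _ _] := coneC.
by apply: CD => //; apply: cone_scalar => //; apply: ltW.
Qed.

Lemma cone_closure_cone (R : realType) (A : comAlgType R) (C : set A) :
  unital_cone C -> unital_cone (cone_closure C).
Proof.
move=> coneC; have [CD CZ C1] := coneC; split.
- move=> c d Cc Cd e e0.
  have e2 : 0 < e / 2 by lra.
  have -> : c + d + e%:A = (c + (e / 2)%:A) + (d + (e / 2)%:A).
    by rewrite addrACA -scalerDl -splitr.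
  by apply: CD; [apply: Cc|apply: Cd].
- move=> l c; rewrite le_eqVlt => /predU1P[<-|l0] Cc e e0.
    by rewrite scale0r add0r; apply: cone_scalar => //; apply: ltW.
  have -> : l *: c + e%:A = l *: (c + (e / l)%:A).
    by rewrite scalerDr scalerA mulrC divfK// lt0r_neq0.
  by apply: CZ; [exact: ltW|apply: Cc; exact: divr_gt0].
- exact: sub_cone_closure.
Qed.

Lemma multipliers_semiring (R : realType) (A : comAlgType R) (C : set A) :
  unital_cone C -> semiring (multipliers C).
Proof.
move=> [CD CZ _]; split => [s t Cs Ct c Cc|s t Cs Ct c Cc|l l0 c Cc].
- by rewrite mulrDl; apply: CD; [apply: Cs|apply: Ct].
- by rewrite -mulrA; apply/Cs/Ct.
- by rewrite mulr_algl; apply: CZ.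
Qed.

Lemma quadratic_module_cone (R : realType) (A : comAlgType R) (Q : set A) :
  quadratic_module Q -> unital_cone Q.
Proof.
move=> [QD Q1 QM]; split => // l c l0 Qc.
rewrite -mulr_algl -(sqr_sqrtr l0).
by have -> : (Num.sqrt l ^+ 2)%:A = (Num.sqrt l)%:A ^+ 2 :> A;
  [alg_ring|apply: QM].
Qed.

(** A substitute for writing [1 - y] as the square of a power series.  The identity
    [2 * (1 - Y) = (1 - Y) ^+ 2 + (1 - Y ^+ 2)], iterated from [Y = y], shows
    that [(1 - y) * c] dominates [2 ^- n * (1 - y ^+ (2 ^ n)) * c].  The even
    power of [y] is at most [1] modulo [Q], so this term is at least
    [- N * 2 ^- n] for any scalar [N] bounding [c]. *)
Lemma one_sub_mul_closure (R : realType) (A : comAlgType R) (Q : set A)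
    (y c : A) :
  quadratic_module Q -> archimedean Q -> Q (1 - y ^+ 2) -> Q c ->
  cone_closure Q ((1 - y) * c).
Proof.
move=> qmQ arQ Qy Qc e e0; have [QD Q1 QM] := qmQ.
have coneQ := quadratic_module_cone qmQ; have [_ QZ _] := coneQ.
have Q0 : Q 0 by rewrite -(scale0r 1); apply: QZ.
have telescope n : Q (2 ^+ n * ((1 - y) * c) - (1 - y ^+ (2 ^ n)) * c).
  elim: n => [|n IHn]; first by rewrite mul1r expr1 subrr.
  rewrite expnSr exprM; set Y := y ^+ (2 ^ n) in IHn *.
  have -> : 2 ^+ n.+1 * ((1 - y) * c) - (1 - Y ^+ 2) * c =
    2 *: (2 ^+ n * ((1 - y) * c) - (1 - Y) * c) + (1 - Y) ^+ 2 * c.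
    by rewrite exprS; alg_ring.
  by apply: QD; [apply: QZ|apply: QM].
have even_le1 m : Q (1 - (y ^+ m) ^+ 2).
  elim: m => [|m IHm]; first by rewrite expr0 expr1n subrr.
  have -> : 1 - (y ^+ m.+1) ^+ 2 =
      (y ^+ m) ^+ 2 * (1 - y ^+ 2) + (1 - (y ^+ m) ^+ 2).
    by rewrite [y ^+ m.+1]exprS; ring.
  by apply: QD => //; apply: QM.
have [N N0 QN] := arQ c.
pose n := (Num.bound (N / e)).+1.
have Ne : N / 2 ^+ n <= e.
  rewrite ler_pdivrMr ?exprn_gt0// mulrC -ler_pdivrMr//.
  apply: (le_trans (ltW (archi_boundP _))); first by rewrite divr_ge0// ltW.
  by rewrite -natrX ler_nat /n; apply/ltnW/ltnW/ltn_expl.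
have Qpow : Q (N%:A - y ^+ (2 ^ n) * c).
  (* [n] is positive, so [2 ^ n] is even. *)
  rewrite /n expnSr exprM; set Y := y ^+ _.
  have -> : N%:A - Y ^+ 2 * c = Y ^+ 2 * (N%:A - c) + N *: (1 - Y ^+ 2).
    alg_ring.
  by apply: QD; [apply: QM|apply: QZ; [exact: ltW|exact: even_le1]].
have Qsum : Q (2 ^+ n * ((1 - y) * c) + N%:A).
  have -> : 2 ^+ n * ((1 - y) * c) + N%:A =
    (2 ^+ n * ((1 - y) * c) - (1 - y ^+ (2 ^ n)) * c) + c +
      (N%:A - y ^+ (2 ^ n) * c) by ring.
  by apply: (QD) => //; apply: QD.
have -> : (1 - y) * c + e%:A =
    (2 ^+ n)^-1 *: (2 ^+ n * ((1 - y) * c) + N%:A) + (e - N / 2 ^+ n)%:A.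
  have -> : 2 ^+ n * ((1 - y) * c) = 2 ^+ n *: ((1 - y) * c).
    by rewrite scale_in_alg rmorphXn rmorph_nat.
  rewrite scalerDr scalerA mulVf ?lt0r_neq0 ?exprn_gt0// scale1r scalerA.
  by alg_ring.
apply: QD; first by apply: QZ => //; rewrite invr_ge0 exprn_ge0.
by apply: cone_scalar => //; rewrite subr_ge0.
Qed.

(** To multiply an element [c] of the closure, apply [one_sub_mul_closure] to
    [c + d] in [Q]; the error [d * y] which this creates is at least [- d] modulo [Q],
    as [1 + y] is in [Q]. *)
Lemma one_sub_multiplier (R : realType) (A : comAlgType R) (Q : set A)
    (y : A) :
  quadratic_module Q -> archimedean Q -> Q (1 - y ^+ 2) ->
  multipliers (cone_closure Q) (1 - y).
Proof.
move=> qmQ arQ Qy c Qc e e0; have [QD Q1 QM] := qmQ.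
have [_ QZ _] := quadratic_module_cone qmQ.
pose d := e / 3; have d0 : 0 < d by rewrite divr_gt0.
have Q1y : Q (1 + y).
  have -> : 1 + y = 2^-1 *: ((1 + y) ^+ 2 * 1 + (1 - y ^+ 2)).
    have -> : (1 + y) ^+ 2 * 1 + (1 - y ^+ 2) = 2%:R *: (1 + y) by alg_ring.
    by rewrite scalerA mulVf ?lt0r_neq0// scale1r.
  by apply: QZ; [rewrite invr_ge0|apply: QD => //; apply: QM].
have -> : (1 - y) * c + e%:A =
    ((1 - y) * (c + d%:A) + d%:A) + d *: (1 + y).
  have -> : e = d + d + d by rewrite /d; field.
  by alg_ring.
apply: QD; last by apply: QZ => //; apply: ltW.
by apply: one_sub_mul_closure => //; apply: Qc.
Qed.

(** If [l - a ^+ 2] is in [Q], then [y = a / k] satisfies [1 - y ^+ 2] in [Q] once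
    [l <= k ^+ 2], and [k - a] is [k * (1 - y)]. *)
Lemma multipliers_archimedean (R : realType) (A : comAlgType R) (Q : set A) :
  quadratic_module Q -> archimedean Q ->
  archimedean (multipliers (cone_closure Q)).
Proof.
move=> qmQ arQ a; have coneQ := quadratic_module_cone qmQ.
have [QD QZ _] := coneQ.
have [_ SM SR] := multipliers_semiring (cone_closure_cone coneQ).
have [l l0 Ql] := arQ (a ^+ 2).
(* Any [k > 0] with [l <= k ^+ 2] would do. *)
pose k := l + 1; have k0 : 0 < k by rewrite addr_gt0.
have kV : k * k^-1 = 1 by rewrite divff// lt0r_neq0.
exists k => //.
have -> : k%:A - a = k%:A * (1 - k^-1 *: a).
  by rewrite mulr_algl scalerBr scalerA kV scale1r.
apply: SM; first by apply: SR; exact: ltW.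
apply: one_sub_multiplier => //.
have -> : 1 - (k^-1 *: a) ^+ 2 =
    (k^-1 ^+ 2) *: ((l%:A - a ^+ 2) + (k ^+ 2 - l)%:A).
  have {1}-> : 1 = ((k * k^-1) ^+ 2)%:A :> A by rewrite kV expr1n scale1r.
  by alg_ring.
apply: QZ; first by rewrite sqr_ge0.
apply: QD => //; apply: cone_scalar => //; rewrite /k; nra.
Qed.

Lemma cone_closure_characters (R : realType) (A : comAlgType R) (C : set A)
    (chi : {lrmorphism A -> R^o}) :
  unital_cone C -> characters (cone_closure C) chi -> characters C chi.
Proof. by move=> coneC chiC c /(sub_cone_closure coneC); apply: chiC. Qed.

Lemma quadratic_positivstellensatz (R : realType) (A : comAlgType R)
    (Q : set A) (a : A) :
  quadratic_module Q -> archimedean Q ->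
  (forall chi : {lrmorphism A -> R^o}, characters Q chi -> 0 < (chi a : R)) ->
  exists2 eps : R, 0 < eps & Q (a - eps%:A).
Proof.
move=> qmQ arQ apos; have coneQ := quadratic_module_cone qmQ.
have coneQ' := cone_closure_cone coneQ.
have [||||eps e0 Qe] := @module_positivstellensatz R A
    (multipliers (cone_closure Q)) (cone_closure Q) a.
- exact: multipliers_semiring.
- exact: multipliers_archimedean.
- by split => // s c; apply.
- by move=> chi chiQ; apply/apos/cone_closure_characters.
have e2 : 0 < eps / 2 by rewrite divr_gt0.
exists (eps / 2) => //.
have -> : a - (eps / 2)%:A = a - eps%:A + (eps / 2)%:A.
  by rewrite {2}(splitr eps) scalerDl; ring.
exact: Qe.
Qed.

Theorem theorem12p43 (R : realType) (A : comAlgType R) (C : set A)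
    (hC : (exists S : set A,
             [/\ semiring S, archimedean S & semiring_module S C])
          \/ (quadratic_module C /\ archimedean C))
    (a : A) :
  (forall chi : {lrmorphism A -> R^o}, characters C chi -> 0 < (chi a : R))
  <-> (exists2 eps : R, 0 < eps & C (a - eps%:A)).
Proof.
split.
  case: hC => [[S [srS arS modC]]|[qmC arC]].
    exact: module_positivstellensatz srS arS modC.
  exact: quadratic_positivstellensatz.
move=> [eps e0 Ce] chi /(_ _ Ce).
have -> : chi (a - eps%:A) = chi a - eps :> R^o.
  rewrite rmorphB; congr (_ - _).
  by rewrite -[RHS]mulr1 -(rmorph1 chi); exact: linearZ_LR.
by rewrite subr_ge0; exact: lt_le_trans.
Qed.
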